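(* (Completeness.) Let $\Phi$ be a logic program and $A$ an atomic formula. If $n:[\forall\underline{x}].\ \Rightarrow A$ is derivable given axioms $\Phi$, where $n$ is a proof term in normal form, then $\Phi\vdash\{A\}\leadsto^*_\gamma\emptyset$ for some substitution $\gamma$.
   Context: First-order terms $t ::= x \mid f(t_1,\dots,t_n)$; atomic formulas $P(t_1,\dots,t_n)$; Horn formulas $[\forall \underline{x}].\ A_1,\dots,A_n \Rightarrow A$ ($n\ge0$; for $n=0$ written $\Rightarrow A$), $\forall\underline{x}$ quantifying all free term variables, $[\forall\underline{x}].F$ meaning $F$ or $\forall\underline{x}.F$. Proof terms $p,e ::= \kappa \mid a \mid \lambda a.e \mid e\ e'$, normal form w.r.t. beta-reduction $(\lambda a.p)p'\to[p'/a]p$. A logic program $\Phi$ is a list of closed Horn formulas labelled by distinct proof-term constants. Typing given $\Phi$: (axiom) $\kappa:\forall\underline{x}.F$ if $(\kappa:\forall\underline{x}.F)\in\Phi$; (gen) $e:F\Rightarrow e:\forall\underline{x}.F$; (inst) $e:\forall\underline{x}.F\Rightarrow e:[\underline{t}/\underline{x}]F$; (cut) from $e_1:\underline{A}\Rightarrow D$ and $e_2:\underline{B},D\Rightarrow C$ infer $\lambda\underline{a}.\lambda\underline{b}.(e_2\ \underline{b})(e_1\ \underline{a}):\underline{A},\underline{B}\Rightarrow C$ with fresh proof-variable lists $\underline{a},\underline{b}$ of the lengths of $\underline{A},\underline{B}$. LP-Unif reduction: $\Phi\vdash\{A_1,\dots,A_i,\dots,A_n\}\leadsto_{\kappa,\gamma\cdot\gamma'}\{\gamma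 A_1,\dots,\gamma B_1,\dots,\gamma B_m,\dots,\gamma A_n\}$ (current state $\gamma'$) if $\kappa:\forall\underline{x}.B_1,\dots,B_m\Rightarrow C\in\Phi$ (variables renamed apart) and $\gamma$ is a most general unifier of $C$ and $A_i$; $\leadsto^*_\gamma$ is a finite sequence of such steps from the empty substitution with final state $\gamma$. *)

(* Defs.v *)
From Stdlib Require List.
From mathcomp Require Import all_boot.

Set Implicit Arguments.
Unset Strict Implicit.
Unset Printing Implicit Defensive.

Record signature := Signature {
  fsym : eqType; farity : fsym -> nat;
  psym : eqType; parity : psym -> nat }.

Section Language.

Variable S : signature.

Unset Elimination Schemes.
Inductive term : Type :=
| Var (x : nat)
| App (f : fsym S) (ts : {ffun 'I_(farity f) -> term}).
Set Elimination Schemes.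

Definition term_rect (P : term -> Type)
    (PVar : forall x, P (Var x))
    (PApp : forall (f : fsym S) (ts : {ffun 'I_(farity f) -> term}),
      (forall i, P (ts i)) -> P (App ts)) :
    forall t, P t :=
  fix IH t := match t with
    | Var x => PVar x
    | App f ts => PApp f ts (fun i => IH (ts i))
    end.
Definition term_ind (P : term -> Prop) := @term_rect P.

Inductive atom : Type :=
| Atom (p : psym S) (ts : {ffun 'I_(parity p) -> term}).

(* [Horn [:: A1; ..; An] A] is A1, .., An => A. *)
Record horn : Type := Horn { premises : seq atom; conclusion : atom }.

(* [Forall F] quantifies all the variables of [F], so it needs no list of
   bound variables. *)
Inductive formula : Type :=
| Open (F : horn)
| Forall (F : horn).

Definition subst := nat -> term.

(* Substitutions in the usual sense move only finitely many variables; this is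
   required below wherever it matters. *)
Definition finite_subst (s : subst) : Prop :=
  exists N, forall x, N <= x -> s x = Var x.

Fixpoint tsubst (s : subst) (t : term) : term :=
  match t with
  | Var x => s x
  | App f ts => App [ffun i => tsubst s (ts i)]
  end.

Definition asubst (s : subst) (A : atom) : atom :=
  let: Atom p ts := A in Atom [ffun i => tsubst s (ts i)].

Definition hsubst (s : subst) (F : horn) : horn :=
  Horn [seq asubst s B | B <- premises F] (asubst s (conclusion F)).

(* [scomp s s'] is s . s', which applies s' first. *)
Definition scomp (s s' : subst) : subst := fun x => tsubst s (s' x).

Fixpoint toccurs (x : nat) (t : term) : bool :=
  match t with
  | Var y => x == y
  | App f ts => [exists i, toccurs x (ts i)]
  end.

Definition aoccurs (x : nat) (A : atom) : bool :=
  let: Atom p ts := A in [exists i, toccurs x (ts i)].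

Definition hoccurs (x : nat) (F : horn) : bool :=
  has (aoccurs x) (conclusion F :: premises F).

Definition is_unifier (s : subst) (A B : atom) : Prop :=
  finite_subst s /\ asubst s A = asubst s B.

Definition is_mgu (s : subst) (A B : atom) : Prop :=
  is_unifier s A B /\
  forall u, is_unifier u A B ->
    exists2 d, finite_subst d & u =1 scomp d s.

Section Programs.

Variable K : eqType.

(* Proof terms, with de Bruijn indices for the proof variables. *)
Inductive pterm : Type :=
| PConst (k : K)
| PVar (i : nat)
| PLam (e : pterm)
| PApp (e1 e2 : pterm).

(* Add [d] to the free indices of [e], those at least [c]. *)
Fixpoint pshift (d c : nat) (e : pterm) : pterm :=
  match e with
  | PConst k => PConst k
  | PVar i => if i < c then PVar i else PVar (i + d)
  | PLam e => PLam (pshift d c.+1 e)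
  | PApp e1 e2 => PApp (pshift d c e1) (pshift d c e2)
  end.

(* Replace index [c] by [u], removing the binder that [c] refers to. *)
Fixpoint psubst (c : nat) (u e : pterm) : pterm :=
  match e with
  | PConst k => PConst k
  | PVar i =>
      if i < c then PVar i else if i == c then pshift c 0 u else PVar i.-1
  | PLam e => PLam (psubst c.+1 u e)
  | PApp e1 e2 => PApp (psubst c u e1) (psubst c u e2)
  end.

Inductive beta : pterm -> pterm -> Prop :=
| beta_redex p p' : beta (PApp (PLam p) p') (psubst 0 p' p)
| beta_lam p q : beta p q -> beta (PLam p) (PLam q)
| beta_appl p q r : beta p q -> beta (PApp p r) (PApp q r)
| beta_appr p q r : beta p q -> beta (PApp r p) (PApp r q).

Definition normal (p : pterm) : Prop := forall q, ~ beta p q.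

Definition plams (n : nat) (e : pterm) : pterm := iter n PLam e.

Definition papps (e : pterm) (es : seq pterm) : pterm := foldl PApp e es.

(* lambda a_1 .. a_m. lambda b_1 .. b_n. (e2 b_1 .. b_n) (e1 a_1 .. a_m).
   Under the m + n binders, b_n is index 0, b_1 is n - 1, a_m is n and a_1 is
   n + m - 1; the shifts keep the a's and b's fresh for e1 and e2. *)
Definition cut_term (m n : nat) (e1 e2 : pterm) : pterm :=
  plams (m + n)
    (PApp (papps (pshift (m + n) 0 e2) [seq PVar i | i <- rev (iota 0 n)])
          (papps (pshift (m + n) 0 e1) [seq PVar i | i <- rev (iota n m)])).

(* A clause (k, F) stands for the closed formula k : [Forall F]. *)
Record program : Type := Program {
  clauses :> seq (K * horn);
  clauses_uniq : uniq [seq c.1 | c <- clauses] }.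

Inductive typed (Phi : program) : pterm -> formula -> Prop :=
| ty_axiom k F :
    List.In (k, F) Phi -> typed Phi (PConst k) (Forall F)
| ty_gen e F :
    typed Phi e (Open F) -> typed Phi e (Forall F)
| ty_inst e F (s : subst) :
    typed Phi e (Forall F) -> typed Phi e (Open (hsubst s F))
| ty_cut e1 e2 (As Bs : seq atom) (D C : atom) :
    typed Phi e1 (Open (Horn As D)) ->
    typed Phi e2 (Open (Horn (rcons Bs D) C)) ->
    typed Phi (cut_term (size As) (size Bs) e1 e2) (Open (Horn (As ++ Bs) C)).

(* Variables of [F] neither occur in the goals nor are touched by the state. *)
Definition apart (F : horn) (goals : seq atom) (st : subst) : Prop :=
  forall x, hoccurs x F ->
    [/\ ~~ has (aoccurs x) goals, st x = Var x &
        forall y, toccurs x (st y) -> y = x].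

(* One LP-Unif step from (goals, state) to (goals', state'), labelled by the
   constant of the clause; the clause is first renamed apart by [r]. *)
Inductive lp_unif_step (Phi : program) (k : K) :
    seq atom * subst -> seq atom * subst -> Prop :=
| LpUnifStep (F : horn) (r : nat -> nat) (G1 G2 : seq atom) (A : atom)
    (st s : subst) (F' := hsubst (fun x => Var (r x)) F) :
    List.In (k, F) Phi ->
    injective r ->
    apart F' (G1 ++ A :: G2) st ->
    is_mgu s (conclusion F') A ->
    lp_unif_step Phi k
      (G1 ++ A :: G2, st)
      ([seq asubst s B | B <- G1 ++ premises F' ++ G2], scomp s st).

Inductive lp_unif_steps (Phi : program) :
    seq atom * subst -> seq atom * subst -> Prop :=
| lp_unif_refl c : lp_unif_steps Phi c c
| lp_unif_trans k c1 c2 c3 :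
    lp_unif_step Phi k c1 c2 -> lp_unif_steps Phi c2 c3 ->
    lp_unif_steps Phi c1 c3.

Definition lp_unif (Phi : program) (G : seq atom) (s : subst)
    (G' : seq atom) : Prop :=
  lp_unif_steps Phi (G, Var) (G', s).

End Programs.

End Language.

(* Main.v *)
From Stdlib Require List Eqdep_dec.
Require Import Defs.
From mathcomp Require Import all_boot.

Set Implicit Arguments.
Unset Strict Implicit.
Unset Printing Implicit Defensive.

(* Read a clause as its set of instances, and call a list of atoms refutable
   if it can be emptied by replacing an instance of the head of a clause by
   the matching instance of its body.  Every typing rule preserves the property
   "refutability of the premises passes to the conclusion, uniformly under
   substitution and in any context", so the atom A itself is refutable.  A
   refutation is then lifted to an LP-Unif reduction: each of its steps is an
   instance of a step with a most general unifier. *)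

Section Lifting.

Variable S : signature.

Implicit Types (t : term S) (A B : atom S) (G : seq (atom S)) (s u v : subst S).

(** * Substitutions and bounds on variables *)

Lemma tsubst_ext s s' t :
  (forall x, toccurs x t -> s x = s' x) -> tsubst s t = tsubst s' t.
Proof.
elim: t => [x|f ts IH] /= e; first by apply: e; rewrite eqxx.
congr App; apply/ffunP => i; rewrite !ffunE; apply: IH => x xi.
by apply: e; apply/existsP; exists i.
Qed.

Lemma tsubst_Var t : tsubst (@Var S) t = t.
Proof. by elim: t => //= f ts IH; congr App; apply/ffunP => i; rewrite ffunE. Qed.

Lemma tsubst_scomp s s' t : tsubst (scomp s s') t = tsubst s (tsubst s' t).
Proof. by elim: t => //= f ts IH; congr App; apply/ffunP => i; rewrite !ffunE. Qed.

Lemma toccurs_tsubst x s t : toccurs x (tsubst s t) -> exists y, toccurs x (s y).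
Proof.
elim: t => [y|f ts IH] /=; first by exists y.
by case/existsP => i; rewrite ffunE => /IH.
Qed.

Lemma asubst_ext s s' A :
  (forall x, aoccurs x A -> s x = s' x) -> asubst s A = asubst s' A.
Proof.
case: A => p ts /= e; congr Atom; apply/ffunP => i; rewrite !ffunE.
by apply: tsubst_ext => x xi; apply: e; apply/existsP; exists i.
Qed.

Lemma asubst_scomp s s' A : asubst (scomp s s') A = asubst s (asubst s' A).
Proof.
by case: A => p ts /=; congr Atom; apply/ffunP => i; rewrite !ffunE tsubst_scomp.
Qed.

Lemma aoccurs_asubst x s A : aoccurs x (asubst s A) -> exists y, toccurs x (s y).
Proof.
by case: A => p ts /= /existsP[i]; rewrite ffunE => /toccurs_tsubst.
Qed.

Lemma hoccurs_hsubst x s F : hoccurs x (hsubst s F) -> exists y, toccurs x (s y).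
Proof.
rewrite /hoccurs /= has_map => /orP[/aoccurs_asubst //|].
by elim: (premises F) => //= B Bs IH /orP[/aoccurs_asubst|].
Qed.

Lemma map_asubst_ext s s' G :
  (forall x, has (aoccurs x) G -> s x = s' x) ->
  [seq asubst s B | B <- G] = [seq asubst s' B | B <- G].
Proof.
elim: G => //= B G IH e; congr (_ :: _).
  by apply: asubst_ext => x xB; apply: e; rewrite xB.
by apply: IH => x xG; apply: e; rewrite xG orbT.
Qed.

Lemma map_asubst_scomp s s' G :
  [seq asubst (scomp s s') B | B <- G] =
  [seq asubst s B | B <- [seq asubst s' B | B <- G]].
Proof. by rewrite -map_comp; apply: eq_map => B /=; rewrite asubst_scomp. Qed.

Fixpoint tbound t : nat :=
  match t with
  | Var x => x.+1
  | App f ts => \max_i tbound (ts i)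
  end.

Definition abound A : nat := let: Atom p ts := A in \max_i tbound (ts i).

Definition gbound G : nat := \max_(A <- G) abound A.

Lemma toccurs_bound x t : toccurs x t -> x < tbound t.
Proof.
elim: t => [y|f ts IH] /=; first by move/eqP->.
case/existsP => i /IH lt_x; apply: leq_trans lt_x _.
exact: (leq_bigmax (F := fun i => tbound (ts i))).
Qed.

Lemma aoccurs_bound x A : aoccurs x A -> x < abound A.
Proof.
case: A => p ts /= /existsP[i /toccurs_bound lt_x]; apply: leq_trans lt_x _.
exact: (leq_bigmax (F := fun i => tbound (ts i))).
Qed.

Lemma has_aoccurs_bound x G : has (aoccurs x) G -> x < gbound G.
Proof.
rewrite /gbound; elim: G => //= A G IH; rewrite big_cons leq_max.
by case/orP => [/aoccurs_bound->|/IH->]; rewrite ?orbT.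
Qed.

Lemma finite_Var : finite_subst (@Var S).
Proof. by exists 0. Qed.

Lemma finite_scomp s s' :
  finite_subst s -> finite_subst s' -> finite_subst (scomp s s').
Proof.
move=> [N sN] [N' sN']; exists (maxn N N') => x; rewrite geq_max => /andP[Nx N'x].
by rewrite /scomp sN' //= sN.
Qed.

(** These are the two conditions that [apart] puts on the state. Only the finitely many moved
    variables have nontrivial images, so a bound on those images suffices. *)
Lemma finite_subst_range s : finite_subst s ->
  exists N, forall x, N <= x ->
    s x = Var S x /\ forall y, toccurs x (s y) -> y = x.
Proof.
move=> [N sN]; exists (maxn N (\max_(y < N) tbound (s y))) => x.
rewrite geq_max => /andP[Nx Mx]; split=> [|y]; first exact: sN.
case: (leqP N y) => [/sN->/= /eqP-> //|yN /toccurs_bound].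
rewrite ltnNge (leq_trans _ Mx) //.
exact: (leq_bigmax (F := fun y : 'I_N => tbound (s y)) (Ordinal yN)).
Qed.

(** * Existence of most general unifiers *)

Fixpoint tsize t : nat :=
  match t with
  | Var _ => 1
  | App f ts => (\sum_i tsize (ts i)).+1
  end.

Lemma tsize_gt0 t : 0 < tsize t.
Proof. by case: t. Qed.

(** The occurs check: if [x] lies properly inside [t], then [u x] lies properly inside the instance
    of [t], so no [u] unifies them. *)
Lemma toccurs_tsize u x t : toccurs x t ->
  t = Var S x \/ tsize (u x) < tsize (tsubst u t).
Proof.
elim: t => [y /eqP->|f ts IH] /=; [by left | right].
case/existsP: H => i xi; rewrite ltnS (bigD1 i) //= ffunE.
by apply: leq_trans (leq_addr _ _); case: (IH i xi) => [->|/ltnW].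
Qed.

(** Injection yields an equality of dependent pairs, since the type of [ts] depends on [f];
    decidable equality of symbols gives the second components. *)
Lemma App_inj f (ts ts' : {ffun 'I_(farity f) -> term S}) :
  App ts = App ts' -> ts = ts'.
Proof. by case; apply: Eqdep_dec.inj_pair2_eq_dec => x y; apply: eq_comparable. Qed.

Lemma Atom_inj p (ts ts' : {ffun 'I_(parity p) -> term S}) :
  Atom ts = Atom ts' -> ts = ts'.
Proof. by case; apply: Eqdep_dec.inj_pair2_eq_dec => x y; apply: eq_comparable. Qed.

Definition unifies u (E : seq (term S * term S)) : Prop :=
  List.Forall (fun e => tsubst u e.1 = tsubst u e.2) E.

Lemma unifies_cons u e E :
  unifies u (e :: E) <-> tsubst u e.1 = tsubst u e.2 /\ unifies u E.
Proof. exact: List.Forall_cons_iff. Qed.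

Definition equations n (ts ts' : {ffun 'I_n -> term S}) :=
  [seq (ts i, ts' i) | i <- enum 'I_n].

Lemma unifies_equations n (ts ts' : {ffun 'I_n -> term S}) u :
  unifies u (equations ts ts') <->
  [ffun i => tsubst u (ts i)] = [ffun i => tsubst u (ts' i)].
Proof.
rewrite /equations; split=> [uE|/ffunP uE]; last first.
  elim: (enum _) => [|i r IH]; first exact: List.Forall_nil.
  by apply/unifies_cons; split=> //=; have := uE i; rewrite !ffunE.
apply/ffunP => i; rewrite !ffunE; have: i \in enum 'I_n by rewrite mem_enum.
elim: (enum _) uE => //= j r IH /unifies_cons[/= uj /IH ur].
by rewrite inE => /orP[/eqP->|/ur].
Qed.

Definition bind x t : subst S := fun y => if y == x then t else Var S y.

Lemma finite_bind x t : finite_subst (bind x t).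
Proof. by exists x.+1 => y; rewrite /bind; case: eqP => // ->; rewrite ltnn. Qed.

Lemma scomp_bind v x t : v x = tsubst v t -> scomp v (bind x t) =1 v.
Proof. by move=> vx y; rewrite /scomp /bind; case: eqP => //= ->. Qed.

Lemma tsubst_bind_id x t t' : ~~ toccurs x t' -> tsubst (bind x t) t' = t'.
Proof.
move=> xt'; rewrite -[RHS]tsubst_Var; apply: tsubst_ext => y yt'.
by rewrite /bind; case: eqP => // yx; rewrite yx (negPf xt') in yt'.
Qed.

Definition bind_eqs x t (E : seq (term S * term S)) :=
  [seq (tsubst (bind x t) e.1, tsubst (bind x t) e.2) | e <- E].

Lemma unifies_bind_eqs v x t E :
  unifies v (bind_eqs x t E) <-> unifies (scomp v (bind x t)) E.
Proof.
rewrite /unifies List.Forall_map.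
by split; apply: List.Forall_impl => e /=; rewrite !tsubst_scomp.
Qed.

Lemma unifies_eq1 u v E : u =1 v -> unifies u E -> unifies v E.
Proof.
move=> uv; apply: List.Forall_impl => e.
by rewrite !(@tsubst_ext u v).
Qed.

(** The factor is [v] itself, so it is finite as soon as [v] is, and no witness has to be carried
    through the induction. *)
Definition strong_mgu s E : Prop :=
  [/\ finite_subst s, unifies s E & forall v, unifies v E -> v =1 scomp v s].

Lemma strong_mgu_equiv s E E' :
  (forall v, unifies v E <-> unifies v E') -> strong_mgu s E' -> strong_mgu s E.
Proof.
by move=> EE' [fs sE' gs]; split=> // [|v /EE'/gs //]; apply/EE'.
Qed.

(** A unifier [v] of [x] and [t] absorbs [bind x t], hence unifies the reduced equations and absorbs
    [s] too. *)
Lemma strong_mgu_bind s x t E : ~~ toccurs x t ->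
  strong_mgu s (bind_eqs x t E) ->
  strong_mgu (scomp s (bind x t)) ((Var S x, t) :: E).
Proof.
move=> xt [fs sE gs]; split.
- by apply: finite_scomp => //; apply: finite_bind.
- apply/unifies_cons; split; last exact/unifies_bind_eqs.
  by rewrite !tsubst_scomp /= (tsubst_bind_id _ xt) /bind eqxx.
- move=> v /unifies_cons[/= vx vE] y.
  have vb := scomp_bind vx.
  have vs : v =1 scomp v s.
    by apply: gs; apply/unifies_bind_eqs; apply: unifies_eq1 vE => z; rewrite vb.
  rewrite -[LHS]vb /scomp -tsubst_scomp; apply: tsubst_ext => z _.
  exact: vs.
Qed.

(** Left-hand sides suffice: when [u] unifies [E], the right-hand sides have the same instances. *)
Definition instance_size u (E : seq (term S * term S)) : nat :=
  \sum_(e <- E) tsize (tsubst u e.1).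

(** The equation is trivial, excluded by the occurs check, or eliminated by [bind x t]. As [u]
    absorbs [bind x t], elimination keeps the measure of [E], and the removed equation accounts for
    the decrease. *)
Lemma strong_mgu_var x t E u :
  (forall E', instance_size u E' < instance_size u ((Var S x, t) :: E) ->
     unifies u E' -> exists s, strong_mgu s E') ->
  unifies u ((Var S x, t) :: E) -> exists s, strong_mgu s ((Var S x, t) :: E).
Proof.
move=> IH /unifies_cons[/= ux uE].
have ltE E' : instance_size u E' = instance_size u E ->
    instance_size u E' < instance_size u ((Var S x, t) :: E).
  by move=> ->; rewrite /instance_size big_cons -add1n leq_add2r tsize_gt0.
case: (boolP (toccurs x t)) => [/(toccurs_tsize u)[tx|]|xt].
- have [s sE] := IH _ (ltE E erefl) uE.
  exists s; apply: strong_mgu_equiv sE => v; rewrite tx.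
  by split=> [/unifies_cons[]|vE] //; apply/unifies_cons.
- by rewrite ux ltnn.
- have ub := scomp_bind ux.
  have [||s sE] := IH (bind_eqs x t E); first apply: ltE.
  + rewrite /instance_size big_map; apply: eq_bigr => e _ /=.
    by rewrite -tsubst_scomp; congr tsize; apply: tsubst_ext => y _; apply: ub.
  + by apply/unifies_bind_eqs; apply: unifies_eq1 uE => y; rewrite ub.
  + by exists (scomp s (bind x t)); apply: strong_mgu_bind.
Qed.

(* The size of the instance by a fixed unifier decreases at every step of the
   unification algorithm, including the elimination of a variable. *)
Lemma strong_mgu_exists u E : unifies u E -> exists s, strong_mgu s E.
Proof.
have [n] := ubnP (instance_size u E).
elim: n E => // n IH [|[t1 t2] E] lt_n uE.
  exists (@Var S); split; [exact: finite_Var | exact: List.Forall_nil |].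
  by move=> v _ x.
have {}IH E' : instance_size u E' < instance_size u ((t1, t2) :: E) ->
    unifies u E' -> exists s, strong_mgu s E'.
  by move=> lt_E'; apply: IH; apply: leq_trans lt_E' _.
case: t1 => [x|f ts] in lt_n uE IH *; first exact: (strong_mgu_var IH uE).
case: t2 => [x|g ts'] in lt_n uE IH *.
  have swap v : unifies v ((App ts, Var S x) :: E) <->
                unifies v ((Var S x, App ts) :: E).
    by split=> /unifies_cons[e vE]; apply/unifies_cons; split.
  have /swap uE' := uE; have [/= utx _] := (unifies_cons _ _ _).1 uE.
  have [|s sE] := strong_mgu_var _ uE'.
    (* Both sides have the same instance under [u], so swapping them preserves the measure. *)
    move=> E'; rewrite {2}/instance_size big_cons /= -utx => lt_E'.
    by apply: IH; rewrite {2}/instance_size big_cons.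
  by exists s; apply: strong_mgu_equiv sE.
have [/= ufg _] := (unifies_cons _ _ _).1 uE.
have fg : f = g by case: ufg.
case: _ / fg in ts' uE IH lt_n ufg *.
have decompose v : unifies v ((App ts, App ts') :: E) <->
                   unifies v (equations ts ts' ++ E).
  rewrite unifies_cons /unifies List.Forall_app.
  split=> -[vts vE]; split=> //; first by apply/unifies_equations/App_inj.
  by move/unifies_equations: vts => /= ->.
have [||s sE] := IH (equations ts ts' ++ E); last 2 first.
- exact/decompose.
- by exists s; apply: strong_mgu_equiv sE.
(* Removing the head symbol lowers the measure by exactly one. *)
rewrite /instance_size big_cat big_cons big_map big_enum /= addSn ltnS.
by rewrite leq_add2r; apply: eq_leq; apply: eq_bigr => i _; rewrite ffunE.
Qed.

Lemma mgu_exists u A B : is_unifier u A B -> exists s, is_mgu s A B.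
Proof.
case: A B => p ts [q ts'] [fu uAB].
have pq : p = q by case: uAB.
case: _ / pq in ts' uAB *.
have unifierE v : asubst v (Atom ts) = asubst v (Atom ts') <->
                  unifies v (equations ts ts').
  rewrite unifies_equations; split=> [|/= -> //]; exact: Atom_inj.
have [s [fs /unifierE sAB gs]] := strong_mgu_exists ((unifierE u).1 uAB).
by exists s; split=> // v [fv /unifierE/gs vs]; exists v.
Qed.

(** * Refutations by clause instances, and their lifting to LP-Unif *)

Section Refutation.

Variables (K : eqType) (Phi : program S K).

Inductive refutable : seq (atom S) -> Prop :=
| refutable_nil : refutable [::]
| refutable_cons k F s G :
    List.In (k, F) Phi ->
    refutable ([seq asubst s B | B <- premises F] ++ G) ->
    refutable (asubst s (conclusion F) :: G).

(* Quantifying over the context [G] gives transitivity without an exchange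
   lemma for [refutable]. *)
Definition provable A : Prop := forall G, refutable G -> refutable (A :: G).

(** Quantifying over [s] gives [Open F] and [Forall F] one meaning, which settles generalization and
    instantiation. *)
Definition valid (F : horn S) : Prop :=
  forall s, List.Forall (fun B => provable (asubst s B)) (premises F) ->
    provable (asubst s (conclusion F)).

Lemma valid_hsubst s F : valid F -> valid (hsubst s F).
Proof.
move=> vF s' /=; rewrite List.Forall_map -asubst_scomp => pF; apply: vF.
by apply: List.Forall_impl pF => B; rewrite asubst_scomp.
Qed.

Lemma valid_clause k F : List.In (k, F) Phi -> valid F.
Proof.
move=> kF s pF G rG; apply: refutable_cons kF _.
by elim: pF => //= B Bs pB _ IH; apply: pB.
Qed.

(** For a cut, validity of the first formula makes the instance of [D] provable, which supplies the
    last premise of the second. *)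
Lemma typed_valid e P :
  typed Phi e P -> valid (match P with Open F => F | Forall F => F end).
Proof.
elim=> //= [k F|{}e F s _|e1 e2 As Bs D C _ IH1 _ IH2].
- exact: valid_clause.
- exact: valid_hsubst.
move=> s /List.Forall_app[pAs pBs]; apply: IH2 => /=.
rewrite -cats1; apply/List.Forall_app; split=> //.
by apply: List.Forall_cons; [apply: IH1 | apply: List.Forall_nil].
Qed.

(** On disjoint variables, [s] and [s0] merge into one unifier [u] of the goal and the renamed head;
    [d] is the factor of [u] through a most general unifier. *)
Lemma lift_refutation_step k F s0 s A G st : List.In (k, F) Phi ->
  finite_subst s -> finite_subst st ->
  asubst s A = asubst s0 (conclusion F) ->
  exists G' st' d,
    [/\ lp_unif_step Phi k (A :: G, st) (G', st'),
        finite_subst st', finite_subst d &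
        [seq asubst d B | B <- G'] =
        [seq asubst s0 B | B <- premises F] ++ [seq asubst s B | B <- G]].
Proof.
move=> kF [N1 sN1] fst sA; have [N2 stN2] := finite_subst_range fst.
(* Shifting the clause by [N] takes its variables past those of the goals and those touched by the
   state. *)
set N := maxn (maxn N1 N2) (gbound (A :: G)).
pose M := gbound (conclusion F :: premises F).
pose F' := hsubst (fun x => Var S (x + N)) F.
(* [s0] may move infinitely many variables; cutting it off at [M], beyond the variables of the
   clause, makes [u] finite. *)
pose u x := if x < N then s x else if x - N < M then s0 (x - N) else Var S x.
have fu : finite_subst u.
  exists (N + M) => x le_x; rewrite /u ltnNge (leq_trans (leq_addr _ _) le_x) /=.
  by rewrite ltnNge leq_subRL ?le_x // (leq_trans (leq_addr _ _) le_x).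
have uG x : has (aoccurs x) (A :: G) -> u x = s x.
  by move/has_aoccurs_bound => lt_x; rewrite /u leq_max lt_x orbT.
have uF x : has (aoccurs x) (conclusion F :: premises F) -> u (x + N) = s0 x.
  by move/has_aoccurs_bound => lt_x; rewrite /u ltnNge leq_addl /= addnK lt_x.
have uA : asubst u A = asubst s A.
  by apply: asubst_ext => x xA; apply: uG; rewrite /= xA.
have uC : asubst u (conclusion F') = asubst s0 (conclusion F).
  rewrite -asubst_scomp; apply: asubst_ext => x xC.
  by apply: uF; rewrite /= xC.
have [m mgu_m] : exists m, is_mgu m (conclusion F') A.
  by apply: (mgu_exists (u := u)); split=> //; rewrite uA uC.
have [[fm _] gm] := mgu_m.
have [|d fd ud] := gm u; first by split=> //; rewrite uA uC.
exists [seq asubst m B | B <- [::] ++ premises F' ++ G], (scomp m st), d; split=> //.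
- apply: (@LpUnifStep _ _ _ k F (addn^~ N) [::] G A st m kF) => //.
    exact: addIn.
  move=> x /hoccurs_hsubst[y /= /eqP x_def].
  have: N <= x by rewrite x_def leq_addl.
  rewrite !geq_max => /andP[/andP[_ /stN2[stx sty]] Gx]; split=> //.
  by apply/negP => /(has_aoccurs_bound (G := A :: G)); rewrite ltnNge Gx.
- exact: finite_scomp.
have -> : [seq asubst d B | B <- [seq asubst m B | B <- premises F' ++ G]] =
          [seq asubst u B | B <- premises F' ++ G].
  by rewrite -map_asubst_scomp; apply: map_asubst_ext => x _; rewrite ud.
rewrite map_cat; congr (_ ++ _); last first.
  by apply: map_asubst_ext => x xG; apply: uG; rewrite /= xG orbT.
rewrite -map_asubst_scomp; apply: map_asubst_ext => x xF.
by apply: uF; rewrite /= xF orbT.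
Qed.

(** The invariant is that the refuted list is an instance of the current goals; each step replaces
    the instantiating substitution by the factor [d]. *)
Lemma lift_refutation G s st : finite_subst s -> finite_subst st ->
  refutable [seq asubst s B | B <- G] ->
  exists st', lp_unif_steps Phi (G, st) ([::], st').
Proof.
move=> + + rG; move: {-2}[seq _ | _ <- _] rG (erefl [seq asubst s B | B <- G]).
move=> H rH; elim: rH G s st => [|k F s0 H' kF _ IH] [|A G] s st //.
  by move=> _ _ _; exists st; apply: lp_unif_refl.
case=> sA sG fs fst.
have [G' [st' [d [step fst' fd dG']]]] := lift_refutation_step G kF fs fst sA.
have [|st'' steps] := IH G' d st' _ fd fst'; first by rewrite dG' sG.
by exists st''; apply: lp_unif_trans step steps.
Qed.

End Refutation.

End Lifting.

Theorem theorem7 (S : signature) (K : eqType) (Phi : program S K)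
    (A : atom S) (n : pterm K) :
  normal n ->
  typed Phi n (Open (Horn [::] A)) \/ typed Phi n (Forall (Horn [::] A)) ->
  exists s : subst S, lp_unif Phi [:: A] s [::].
Proof.
move=> _ tA.
have vA : valid Phi (Horn [::] A) by case: tA => /typed_valid.
(* The identity serves both as the instantiating substitution and as the initial state. *)
apply: (lift_refutation (s := @Var S)); [exact: finite_Var | exact: finite_Var |].
by apply: (vA (@Var S) (List.Forall_nil _)); apply: refutable_nil.
Qed.
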